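(* Let $K$ be a cubic field such that the discriminant of its quadratic resolvent field $\mathbf{Q}(\sqrt{\Delta(K)})$ is divisible by $3$. Then \[\mathrm{ord}_3\,\Delta\big(T_K^{\perp\prime}\big)=\begin{cases}0&\text{if }3\text{ is wildly ramified in }K,\\ 2&\text{if }3\text{ is tamely ramified in }K.\end{cases}\]
   Context: $\Delta(K)$ is the discriminant of $K$. With $\alpha^\perp:=3\alpha-\mathrm{Tr}_{K/\mathbf{Q}}(\alpha)$ and $1,\alpha_1,\alpha_2$ a $\mathbf{Z}$-basis of $\mathcal{O}_K$, the trace-zero form is the integral binary quadratic form $T_K^\perp(x,y)=\mathrm{Tr}_{K/\mathbf{Q}}((x\alpha_1^\perp+y\alpha_2^\perp)^2)$, and $T_K^{\perp\prime}$ is the primitive form obtained by dividing $T_K^\perp$ by the gcd of its coefficients. The discriminant of $rx^2+sxy+ty^2$ is $s^2-4rt$. The prime $3$ is wildly ramified in $K$ if $3\mathcal{O}_K=\mathfrak{p}^3$, and tamely ramified if $3\mathcal{O}_K=\mathfrak{p}_1^2\mathfrak{p}_2$ with $\mathfrak{p}_1\neq\mathfrak{p}_2$. *)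

(* Defs.v *)
From mathcomp Require Import all_boot all_order all_algebra all_field.
From mathcomp Require Import boolp classical_sets.

Set Implicit Arguments.
Unset Strict Implicit.
Unset Printing Implicit Defensive.

Import GRing.Theory.

Local Open Scope ring_scope.
Local Open Scope classical_set_scope.

(* Number fields are values of type [fieldExtType rat]. *)

(* The trace of the Q-linear map y |-> x * y, read off in a Q-basis of K. *)
Definition trQ (K : fieldExtType rat) (x : K) : rat :=
  \sum_(i < \dim {:K}) coord (vbasis {:K}) i (x * (vbasis {:K})`_i).

Definition ringOfIntegers (K : fieldExtType rat) : set K :=
  [set x | integralOver (intr : int -> K) x].
Arguments ringOfIntegers : clear implicits.

Definition integral_basis (K : fieldExtType rat) (n : nat) (b : n.-tuple K) :
    Prop :=
  (forall i : 'I_n, ringOfIntegers K (tnth b i)) /\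
  (forall x : K, ringOfIntegers K x ->
     exists! c : {ffun 'I_n -> int}, x = \sum_(i < n) (c i)%:~R * tnth b i).

(* [is_discriminant K d]: d is the discriminant of K. The determinant does not
   depend on the integral basis, so d is determined by K. *)
Definition is_discriminant (K : fieldExtType rat) (d : int) : Prop :=
  exists (n : nat) (b : n.-tuple K),
    integral_basis b /\
    d%:~R = \det (\matrix_(i < n, j < n) trQ (tnth b i * tnth b j)).

(* L is (isomorphic to) Q(sqrt D); this includes L = Q when D is a square. *)
Definition is_Q_adjoin_sqrt (D : int) (L : fieldExtType rat) : Prop :=
  exists delta : L,
    delta ^+ 2 = D%:~R /\ <<1; delta>>%VS = {:L}%VS.

(* Ideals of the ring of integers, as subsets of K. *)
Definition is_ideal (K : fieldExtType rat) (I : set K) : Prop :=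
  [/\ I `<=` ringOfIntegers K,
      I 0,
      forall x y, I x -> I y -> I (x + y) &
      forall a x, ringOfIntegers K a -> I x -> I (a * x)].

Definition is_prime_ideal (K : fieldExtType rat) (P : set K) : Prop :=
  [/\ is_ideal P,
      ~ P 1 &
      forall x y, ringOfIntegers K x -> ringOfIntegers K y ->
        P (x * y) -> P x \/ P y].

Definition ideal_mul (K : fieldExtType rat) (I J : set K) : set K :=
  [set x | exists s : seq (K * K),
     (forall u, u \in s -> I u.1 /\ J u.2) /\ x = \sum_(u <- s) u.1 * u.2].

Definition principal_ideal (K : fieldExtType rat) (a : K) : set K :=
  [set a * y | y in ringOfIntegers K].

Definition wildly_ramified3 (K : fieldExtType rat) : Prop :=
  exists P : set K, is_prime_ideal P /\
    principal_ideal (3%:R : K) = ideal_mul (ideal_mul P P) P.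

Definition tamely_ramified3 (K : fieldExtType rat) : Prop :=
  exists P1 P2 : set K,
    [/\ is_prime_ideal P1, is_prime_ideal P2, P1 <> P2 &
        principal_ideal (3%:R : K) = ideal_mul (ideal_mul P1 P1) P2].

(* BQF r s t is the form r x^2 + s x y + t y^2. *)
Record bqf : Type := BQF { bqf_r : int; bqf_s : int; bqf_t : int }.

Definition bqf_eval (Q : bqf) (x y : int) : int :=
  bqf_r Q * x ^+ 2 + bqf_s Q * x * y + bqf_t Q * y ^+ 2.

Definition bqf_disc (Q : bqf) : int :=
  bqf_s Q ^+ 2 - 4%:R * bqf_r Q * bqf_t Q.

Definition bqf_content (Q : bqf) : int :=
  gcdz (bqf_r Q) (gcdz (bqf_s Q) (bqf_t Q)).

Definition bqf_prim (Q : bqf) : bqf :=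
  BQF (bqf_r Q %/ bqf_content Q)%Z
      (bqf_s Q %/ bqf_content Q)%Z
      (bqf_t Q %/ bqf_content Q)%Z.

Definition perp (K : fieldExtType rat) (a : K) : K :=
  3%:R * a - (trQ a)%:A.

(* A form with integer coefficients is determined by its values on Z^2. *)
Definition is_trace_zero_form (K : fieldExtType rat) (a1 a2 : K) (T : bqf) :
    Prop :=
  forall x y : int,
    (bqf_eval T x y)%:~R = trQ ((x%:~R * perp a1 + y%:~R * perp a2) ^+ 2).

(* [logn p 0 = 0], so this is the p-adic valuation only for z != 0. *)
Definition ord (p : nat) (z : int) : nat := logn p `|z|%N.

(* Main.v *)
(** In both ramified cases the ideal factorization of 3 yields an integral [t]
    such that [1, t, t^2] is independent modulo [3 O], i.e. [Z[t]] has index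
    prime to 3 in [O]. Its polynomial [X^3 + a X^2 + b X + c] is congruent to
    [X^3] (wild) or [X^2 (X - 1)] (tame) modulo 3, and maximality of [O] forces
    [c] to be exactly divisible by 3. On the basis [t, t^2] the trace-zero form
    is an explicit form in [a, b, c], of discriminant [-108] times that of the
    cubic. In the tame case the cubic discriminant has valuation 1 and the
    content of the form has valuation 1. In the wild case the hypothesis on the
    resolvent makes the valuation of the cubic discriminant odd, hence 3 or 5,
    and the form is then divisible by 27 or 81, which exhausts its
    discriminant. *)

Require Import Defs.
From HB Require Import structures.
From mathcomp Require Import all_boot all_order all_algebra all_field.
From mathcomp Require Import boolp classical_sets ring zify.

Import GRing.Theory Num.Theory.

Set Implicit Arguments.
Unset Strict Implicit.
Unset Printing Implicit Defensive.

Local Open Scope ring_scope.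

(** * Traces and integral bases *)

Section Trace.
Variable K : fieldExtType rat.
Implicit Types x y : K.

Lemma trQ_is_linear : linear (@trQ K : K -> rat^o).
Proof.
move=> c x y; rewrite /trQ scaler_sumr -big_split /=; apply: eq_bigr => i _.
by rewrite mulrDl -scalerAl linearP.
Qed.

HB.instance Definition _ :=
  GRing.isLinear.Build rat K rat^o _ (@trQ K) trQ_is_linear.

Lemma trQ_mulz (n : int) x : trQ (n%:~R * x) = n%:~R * trQ x.
Proof. by rewrite mulrzl raddfMz mulrzl. Qed.

(** The trace does not depend on the basis: the transition matrices [P] and [Q] are inverse to each
    other and conjugate [M] into the matrix [N] on [vbasis]. *)
Lemma trQ_mxtrace n (e : n.-tuple K) (M : 'M[rat]_n) x :
    basis_of {:K} e ->
    (forall i, x * tnth e i = \sum_j M i j *: tnth e j) ->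
  trQ x = \tr M.
Proof.
move=> be hM; pose v := vbasis {:K}.
have bv : basis_of {:K} v by exact: vbasisP.
pose N := \matrix_(i < \dim {:K}, j < _) coord v j (x * v`_i).
pose P := \matrix_(i, j) coord v j (tnth e i).
pose Q := \matrix_(i < \dim {:K}, j < _) coord e j v`_i.
have PE i : tnth e i = \sum_j P i j *: v`_j.
  by rewrite {1}(coord_basis bv (memvf (tnth e i))); apply: eq_bigr => j _; rewrite mxE.
have QE (i : 'I_(\dim {:K})) : v`_i = \sum_j Q i j *: tnth e j.
  rewrite {1}(coord_basis be (memvf v`_i)); apply: eq_bigr => j _.
  by rewrite mxE (tnth_nth 0).
have NE (i : 'I_(\dim {:K})) : x * v`_i = \sum_j N i j *: v`_j.
  rewrite {1}(coord_basis bv (memvf (x * v`_i))); apply: eq_bigr => j _.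
  by rewrite mxE.
have ev (m : nat) (f : 'I_m -> rat) (u : 'I_m -> K) j :
    coord v j (\sum_i f i *: u i) = \sum_i f i * coord v j (u i).
  by rewrite linear_sum; apply: eq_bigr => i _; rewrite linearZ.
have ee (m : nat) (f : 'I_m -> rat) (u : 'I_m -> K) j :
    coord e j (\sum_i f i *: u i) = \sum_i f i * coord e j (u i).
  by rewrite linear_sum; apply: eq_bigr => i _; rewrite linearZ.
have PQ : P *m Q = 1%:M.
  apply/matrixP => i j; rewrite !mxE -(coord_free i j (basis_free be)).
  rewrite -tnth_nth PE ee; apply: eq_bigr => k _; by rewrite !mxE.
have QP : Q *m P = 1%:M.
  apply/matrixP => i j; rewrite !mxE -(coord_free i j (basis_free bv)).
  rewrite QE ev; apply: eq_bigr => k _; by rewrite !mxE.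
have MP : M *m P = P *m N.
  apply/matrixP => i j; transitivity (coord v j (x * tnth e i)).
    by rewrite hM ev mxE; apply: eq_bigr => k _; rewrite !mxE.
  rewrite PE mulr_sumr mxE; under eq_bigr => k _ do rewrite -scalerAr.
  by rewrite ev; apply: eq_bigr => k _; rewrite !mxE.
have -> : trQ x = \tr N.
  by apply: eq_bigr => i _; rewrite mxE.
by rewrite -[M]mulmx1 -PQ mulmxA MP -mulmxA mxtrace_mulC -mulmxA QP mulmx1.
Qed.

Lemma trQ1 : trQ (1 : K) = (\dim {:K})%:R.
Proof.
rewrite (trQ_mxtrace (M := 1%:M) (vbasisP {:K})) ?mxtrace1 // => i.
rewrite mul1r (bigD1 i) //= big1 ?addr0 ?mxE ?eqxx ?scale1r // => j ji.
by rewrite mxE eq_sym (negPf ji) scale0r.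
Qed.

Lemma mulzE (n : int) x : n%:~R * x = (n%:~R : rat) *: x.
Proof. by rewrite scaler_int mulrzl. Qed.

Lemma intr_eq0_fieldExt (n : int) : (n%:~R : K) = 0 -> n = 0.
Proof.
move=> h; have : n%:~R *: (1 : K) = 0 by rewrite -mulzE mulr1.
by move/eqP; rewrite scaler_eq0 oner_eq0 orbF intr_eq0 => /eqP.
Qed.

(** A rational relation, cleared of denominators, is an integral expression of 0, and such an
    expression is unique. *)
Lemma integral_basis_free n (b : n.-tuple K) : integral_basis b -> free b.
Proof.
move=> [_ hu]; apply/freeP => k hk.
pose d := \prod_i denq (k i).
have d0 : d != 0 by apply/prodf_neq0 => i _; exact: denq_neq0.
have hz i : exists z : int, d%:~R * k i = z%:~R :> rat.
  exists (numq (k i) * \prod_(j | j != i) denq (k j)).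
  rewrite /d (bigD1 i) //= !intrM mulrC mulrA.
  congr (_ * _); rewrite -{1}(divq_num_den (k i)) divfK //.
  by rewrite intr_eq0 denq_neq0.
have [z hz'] := choice hz.
have O0 : ringOfIntegers K 0 by exact: integral0.
have [c [hc cu]] := hu 0 O0.
have e1 : [ffun=> 0] = c.
  by apply/esym/cu; rewrite big1 // => i _; rewrite ffunE mul0r.
have e2 : [ffun i => z i] = c.
  apply/esym/cu; transitivity (d%:~R * \sum_i k i *: b`_i); last first.
    rewrite mulr_sumr; apply: eq_bigr => i _.
    by rewrite ffunE !mulzE scalerA hz' (tnth_nth 0).
  by rewrite hk mulr0.
move=> i; have := congr1 (fun f : {ffun 'I_n -> int} => f i) (etrans e2 (esym e1)).
rewrite !ffunE => zi; apply/eqP.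
have /eqP := hz' i; rewrite zi mulf_eq0 intr_eq0 (negPf d0) //.
Qed.

(** The Gram matrix is [A G A^T], with [A] the integral matrix of [e] on an integral basis and [G]
    the Gram matrix of the latter, so [m] is the determinant of [A]. *)
Lemma is_discriminant_gram n (e : n.-tuple K) (d : int) :
    is_discriminant K d -> basis_of {:K} e ->
    (forall i, ringOfIntegers K (tnth e i)) ->
  exists m : int,
    \det (\matrix_(i < n, j < n) trQ (tnth e i * tnth e j)) = (m ^+ 2 * d)%:~R.
Proof.
move=> [n' [b [hb hd]]] be he.
have fb := integral_basis_free hb.
have hc i : exists c : {ffun 'I_n' -> int}, tnth e i = \sum_j (c j)%:~R * tnth b j.
  by have [c [? _]] := hb.2 _ (he i); exists c.
have [C hC] := choice hc.
(* The length of an integral basis is not fixed in advance: freeness bounds it above by the degree,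
   and spanning [e] bounds it below. *)
have nn : n' = n.
  rewrite -(size_basis be); apply/eqP; rewrite eqn_leq; apply/andP; split.
    by move: fb; rewrite /free size_tuple => /eqP <-; exact/dimvS/subvf.
  apply: (@leq_trans (\dim <<b>>)); last by rewrite -{2}(size_tuple b) dim_span.
  apply: dimvS; rewrite -(span_basis be); apply/span_subvP => x /tnthP[i ->].
  rewrite hC; apply: memv_suml => j _; rewrite mulzE; apply/memvZ/memv_span.
  exact: mem_tnth.
subst n'.
pose A := \matrix_(i < n, j < n) ((C i j)%:~R : rat).
exists (\det (\matrix_(i, j) C i j)).
have -> : \matrix_(i < n, j < n) trQ (tnth e i * tnth e j) =
    A *m (\matrix_(i < n, j < n) trQ (tnth b i * tnth b j)) *m A^T.
  apply/matrixP => i j; rewrite !mxE.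
  under [RHS]eq_bigr => k _ do rewrite !mxE mulr_suml.
  rewrite exchange_big /= hC mulr_suml raddf_sum; apply: eq_bigr => l _.
  rewrite hC mulr_sumr raddf_sum; apply: eq_bigr => k _ /=.
  by rewrite !mxE -!mulrA trQ_mulz mulrCA trQ_mulz [in RHS](mulrC (trQ _)).

rewrite !det_mulmx det_tr -hd rmorphM rmorphXn /= -det_map_mx.
have -> : map_mx intr (\matrix_(i, j) C i j) = A by apply/matrixP => i j; rewrite !mxE.
by ring.
Qed.

End Trace.

(** * The quadratic resolvent *)

Lemma ord_odd_or_square_factor (p : nat) (z : int) : prime p -> z != 0 ->
  odd (ord p z) \/ exists (j : nat) (u : int), z = (p%:Z ^+ j) ^+ 2 * u /\ ~~ (p %| u)%Z.
Proof.
move=> pp z0; case: (boolP (odd (ord p z))) => [|ev]; [by left | right].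
have z0' : (0 < `|z|)%N by rewrite absz_gt0.
have [m cm em] := pfactor_coprime pp z0'.
have eh : ((ord p z)./2 * 2 = ord p z)%N by rewrite muln2 even_halfK.
exists (ord p z)./2, (Num.sg z * m%:Z); split; last first.
  rewrite dvdzE abszM absz_sg z0 mul1n /=.
  by rewrite -prime_coprime.
have pe : ((p ^ ord p z)%N : int) = p%:Z ^+ ord p z by rewrite -natz natrX natz.
by rewrite -exprM eh [LHS]intEsg em PoszM pe; ring.
Qed.

Section Resolvent.
Variable L : fieldExtType rat.

Lemma dim_adjoin_sqrt (D : int) (x : L) :
  x ^+ 2 = D%:~R -> <<1; x>>%VS = {:L}%VS -> (\dim {:L} <= 2)%N.
Proof.
move=> hx fx; rewrite -fx dim_Fadjoin dimv1 muln1.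
have hp : minPoly 1 x %| ('X^2 - (D%:~R)%:P).
  apply: minPoly_dvdp.
    by rewrite rpredB ?rpredX ?polyOverX // polyOverC rpred_int.
  by rewrite /root !hornerE hx subrr.
have /dvdp_leq := hp; rewrite size_minPoly size_XnsubC // => h.
by apply: h; rewrite -size_poly_eq0 size_XnsubC.
Qed.

Lemma sqrt_integral (D : int) (x : L) :
  x ^+ 2 = D%:~R -> ringOfIntegers L x.
Proof.
move=> hx; exists ('X^2 - D%:P); first exact: monicXnsubC.
by rewrite /root rmorphB /= map_polyXn map_polyC /= !hornerE hx subrr.
Qed.

(** The order Z[sqrt D] has discriminant [4 D], which is a square times [d]. When [L] is Q, the
    basis 1 gives [1 = m^2 d], so [d] is a unit. *)
Lemma disc_adjoin_sqrt_dvd (D d : int) (x : L) : x ^+ 2 = D%:~R ->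
  <<1; x>>%VS = {:L}%VS -> is_discriminant L d -> (d %| 4%:R * D)%Z.
Proof.
move=> hx fx hd; have := dim_adjoin_sqrt hx fx.
have : (0 < \dim {:L})%N by exact: adim_gt0.
move e : (\dim {:L}) => n.
case: n e => [|[|[|n]]] // dim _ _.
  have be : basis_of {:L} [tuple (1 : L)].
    by rewrite basisEfree seq1_free oner_eq0 subvf dim.
  have [|m] := is_discriminant_gram hd be.
    by move=> i; rewrite (tnth_nth 0) (ord1 i) /=; exact: integral1.
  rewrite det_mx11 mxE !(tnth_nth 0) /= mulr1 trQ1 dim => h.
  have {h} /intr_inj : ((1 : int)%:~R : rat) = (m ^+ 2 * d)%:~R by rewrite -h.
  move/(congr1 absz); rewrite abszM => /eqP.
  rewrite eq_sym muln_eq1 => /andP[_ /eqP d1].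
  by rewrite dvdzE d1 dvd1n.
have fr : free [:: x; 1].
  rewrite free_cons seq1_free oner_eq0 andbT span_seq1.
  apply/negP => /Fadjoin_idP x1; move: dim; rewrite -fx x1 dimv1 //.
have be : basis_of {:L} [tuple x; (1 : L)].
  by rewrite basisEfree fr subvf dim.
have [|m] := is_discriminant_gram hd be.
  move=> i; rewrite (tnth_nth 0); case: i => -[|[|//]] _ /=.
    exact: sqrt_integral hx.
  exact: integral1.
have tx : trQ x = 0.
  rewrite (trQ_mxtrace (M := \matrix_(i < 2, j < 2) (if val i == 0%N then
      if val j == 0%N then 0 else D%:~R else if val j == 0%N then 1 else 0)) be).
    by rewrite /mxtrace !big_ord_recl big_ord0 !mxE /= !addr0.
  move=> i; rewrite !big_ord_recl big_ord0 !mxE !(tnth_nth 0) /=.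
  case: i => -[|[|//]] _ /=; rewrite !addr0 ?scale0r ?scale1r ?mulr1 ?addr0 //.
  by rewrite -expr2 hx add0r -[LHS]mulr1 mulzE.
have txx : trQ (x ^+ 2) = D%:~R * 2.
  by rewrite hx -[D%:~R]mulr1 trQ_mulz trQ1 dim.
rewrite (expand_det_row _ 0) !big_ord_recl big_ord0 /cofactor !det_mx11 !mxE /=.
rewrite !(tnth_nth 0) /= !mulr1 !mul1r -expr2 txx tx trQ1 dim.
rewrite !mul0r !addr0 => h.
have {h} /intr_inj : ((4%:R * D)%:~R : rat) = (m ^+ 2 * d)%:~R.
  by rewrite -h intrM; ring.
by move=> ->; rewrite dvdz_mull.
Qed.

End Resolvent.

(** Were the valuation even, an even power of 3 could be removed from [D]: [L] would be Q(sqrt u)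
    with [u] prime to 3, and [d] would divide [4 u]. *)
Lemma resolvent_ord_odd (D d : int) (L : fieldExtType rat) : D != 0 ->
  is_Q_adjoin_sqrt D L -> is_discriminant L d -> (3 %| d)%Z -> odd (ord 3 D).
Proof.
move=> D0 [x [hx fx]] hd h3; case: (@ord_odd_or_square_factor 3 D isT D0) => //.
move=> [j [u [De nu]]]; exfalso.
pose q : int := 3%:Z ^+ j.
have q0 : q%:~R != 0 :> L.
  by apply/eqP => /intr_eq0_fieldExt/eqP; rewrite expf_eq0 andbF.
pose y := x / q%:~R.
have hy : y ^+ 2 = u%:~R.
  rewrite expr_div_n hx De -/q intrM rmorphXn /=; by field.
have fy : <<1; y>>%VS = {:L}%VS.
  apply/eqP; rewrite eqEsubv subvf /= -fx; apply/FadjoinP; split.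
    exact: subv_adjoin.
  have -> : x = q%:~R * y by rewrite /y mulrC divfK.
  by rewrite mulzE memvZ // memv_adjoin.
have := dvdz_trans h3 (disc_adjoin_sqrt_dvd hy fy hd).
rewrite Gauss_dvdzr // => h; by rewrite h in nu.
Qed.

(** * Valuations of binary quadratic forms *)

Lemma ordM p (x y : int) : x != 0 -> y != 0 -> ord p (x * y) = (ord p x + ord p y)%N.
Proof. by move=> x0 y0; rewrite /ord abszM lognM ?absz_gt0. Qed.

Lemma ord_coprime p (w : int) : prime p -> ~~ (p %| w)%Z -> ord p w = 0%N.
Proof. by move=> pp; rewrite dvdzE => nw; rewrite /ord logn_coprime // prime_coprime. Qed.

Lemma ord_pfactor p k (w : int) : prime p -> ~~ (p %| w)%Z -> ord p (p%:Z ^+ k * w) = k.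
Proof.
move=> pp nw; rewrite ordM.
- by rewrite [ord p w]ord_coprime // addn0 /ord abszX pfactorK.
- by rewrite expf_eq0 negb_and; apply/orP; right; have := prime_gt0 pp; case: p {pp nw}.
- by apply: contraNneq nw => ->; rewrite dvdz0.
Qed.

Lemma dvdz_pfactor_ord p k (x : int) :
  prime p -> x != 0 -> ((p%:Z ^+ k)%R %| x)%Z = (k <= ord p x)%N.
Proof. by move=> pp x0; rewrite dvdzE abszX pfactor_dvdn // absz_gt0. Qed.

Lemma Euclid_dvdzM p (x y : int) :
  prime p -> (p %| x * y)%Z = (p %| x)%Z || (p %| y)%Z.
Proof. by move=> pp; rewrite !dvdzE abszM Euclid_dvdM. Qed.

Lemma dvdz_content (d : int) (T : bqf) :
  (d %| bqf_content T)%Z = [&& (d %| bqf_r T)%Z, (d %| bqf_s T)%Z & (d %| bqf_t T)%Z].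
Proof. by rewrite /bqf_content !dvdz_gcd. Qed.

Lemma bqf_disc_content (T : bqf) :
  bqf_disc T = bqf_content T ^+ 2 * bqf_disc (bqf_prim T).
Proof.
have /and3P[hr hs ht] : [&& (bqf_content T %| bqf_r T)%Z,
    (bqf_content T %| bqf_s T)%Z & (bqf_content T %| bqf_t T)%Z].
  by rewrite -dvdz_content dvdzz.
rewrite /bqf_disc /= -{1}(divzK hr) -{1}(divzK hs) -{1}(divzK ht).
by ring.
Qed.

Lemma ord_disc_prim p (T : bqf) : bqf_disc T != 0 ->
  ord p (bqf_disc T) = (2 * ord p (bqf_content T) + ord p (bqf_disc (bqf_prim T)))%N.
Proof.
rewrite bqf_disc_content mulf_eq0 negb_or => /andP[c0 d0].
by rewrite ordM // /ord abszX lognX.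
Qed.

Lemma content_neq0 (T : bqf) : bqf_disc T != 0 -> bqf_content T != 0.
Proof. by apply: contra => /eqP c0; rewrite bqf_disc_content c0 expr0n mul0r. Qed.

(** * Discriminant and trace-zero form of a cubic polynomial *)

Definition cubic_disc (a b c : int) : int :=
  a ^+ 2 * b ^+ 2 - 4 * b ^+ 3 - 4 * a ^+ 3 * c + 18 * a * b * c - 27 * c ^+ 2.

(* For a root [t] of [X^3 + a X^2 + b X + c], the form
   [Tr ((x perp(t) + y perp(t^2))^2)], by Newton's identities. *)
Definition cubic_form (a b c : int) : bqf :=
  BQF (6 * (a ^+ 2 - 3 * b)) (6 * (- 2 * a ^+ 3 + 7 * a * b - 9 * c))
      (6 * (a ^+ 4 - 4 * a ^+ 2 * b + b ^+ 2 + 6 * a * c)).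

Lemma cubic_form_disc a b c : bqf_disc (cubic_form a b c) = - 108 * cubic_disc a b c.
Proof. by rewrite /bqf_disc /cubic_disc /=; ring. Qed.

Lemma ord_108 (x : int) : x != 0 -> ord 3 (- 108 * x) = (3 + ord 3 x)%N.
Proof. by move=> x0; rewrite ordM. Qed.

Lemma ord_gt0_neq0 p x k : ord p x = k.+1 -> x != 0.
Proof. by move=> h; apply/eqP => x0; rewrite x0 /ord logn0 in h. Qed.

(** The form has discriminant of valuation [3 + (2 m + 3) = 2 (m + 3)], so a content divisible by
    [3^(m + 3)] uses up all of it. The cases ask which term of the cubic discriminant has the least
    valuation. *)
Lemma wild_cubic (a b c : int) :
    (3 %| a)%Z -> (3 %| b)%Z -> (3 %| c)%Z -> ~~ (9 %| c)%Z ->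
    (cubic_disc a b c != 0 -> odd (ord 3 (cubic_disc a b c))) ->
  cubic_disc a b c != 0 /\ exists2 m : nat, ord 3 (cubic_disc a b c) = (2 * m + 3)%N
    & (3%:Z ^+ (m + 3) %| bqf_content (cubic_form a b c))%Z.
Proof.
move=> /dvdzP[a1 ->] /dvdzP[b1 ->] /dvdzP[c1 ->] nc hodd.
have {}nc : ~~ (3 %| c1)%Z.
  by apply: contra nc => /dvdzP[q ->]; apply/dvdzP; exists q; ring.
set D := cubic_disc _ _ _ in hodd *.
have [b3|b3] := boolP (3 %| b1)%Z; last first.
  (* Here [- 4 b^3] dominates, with valuation 3. *)
  have De : D = 3%:Z ^+ 3 * (3 * (a1 ^+ 2 * b1 ^+ 2 - 4 * a1 ^+ 3 * c1
      + 6 * a1 * b1 * c1 - 3 * c1 ^+ 2) - 4 * b1 ^+ 3).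
    by rewrite /D /cubic_disc; ring.
  have oD : ord 3 D = 3%N.
    rewrite De ord_pfactor // rpredBl ?[(_ %| 3 * _)%Z]dvdz_mulr // Gauss_dvdzr //.
    by rewrite !exprS expr0 !Euclid_dvdzM // ?(negPf b3) //.
  split; first exact: ord_gt0_neq0 oD.
  exists 0%N => //; rewrite dvdz_content /=; apply/and3P; split; apply/dvdzP.
  - by exists (2 * (a1 ^+ 2 - b1)); ring.
  - by exists (2 * (- 6 * a1 ^+ 3 + 7 * a1 * b1 - 3 * c1)); ring.
  - by exists (2 * (9 * a1 ^+ 4 - 12 * a1 ^+ 2 * b1 + b1 ^+ 2 + 6 * a1 * c1)); ring.
move/dvdzP: b3 => [b2 b2e].
have [a3|a3] := boolP (3 %| a1)%Z; last first.
  (* Now [- 4 a^3 c] dominates, with valuation 4; parity rules this case out. *)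
  have De : D = 3%:Z ^+ 4 * (3 * (3 * a1 ^+ 2 * b2 ^+ 2 - 12 * b2 ^+ 3
      + 6 * a1 * b2 * c1 - c1 ^+ 2) - 4 * (a1 ^+ 3 * c1)).
    by rewrite /D /cubic_disc b2e; ring.
  have oD : ord 3 D = 4%N.
    rewrite De ord_pfactor // rpredBl ?[(_ %| 3 * _)%Z]dvdz_mulr // Gauss_dvdzr //.
    by rewrite !exprS expr0 !Euclid_dvdzM // ?(negPf a3) ?(negPf nc).
  by have := hodd (ord_gt0_neq0 oD); rewrite oD.
move/dvdzP: a3 => [a2 a2e].
(* Now [- 27 c^2] dominates, with valuation 5, since 9 does not divide [c]. *)
have De : D = 3%:Z ^+ 5 * (3 * (9 * a2 ^+ 2 * b2 ^+ 2 - 4 * b2 ^+ 3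
    - 12 * a2 ^+ 3 * c1 + 6 * a2 * b2 * c1) - c1 ^+ 2).
  by rewrite /D /cubic_disc b2e a2e; ring.
have oD : ord 3 D = 5%N.
  rewrite De ord_pfactor // rpredBl ?[(_ %| 3 * _)%Z]dvdz_mulr //.
  by rewrite !exprS expr0 !Euclid_dvdzM // ?(negPf nc).
split; first exact: ord_gt0_neq0 oD.
exists 1%N => //; rewrite dvdz_content /= b2e a2e; apply/and3P; split; apply/dvdzP.
- by exists (2 * (3 * a2 ^+ 2 - b2)); ring.
- by exists (2 * (- 54 * a2 ^+ 3 + 21 * a2 * b2 - c1)); ring.
- by exists (2 * (243 * a2 ^+ 4 - 108 * a2 ^+ 2 * b2 + 3 * b2 ^+ 2 + 6 * a2 * c1)); ring.
Qed.

(** Modulo 9 the discriminant is [- 4 a^3 c] and the leading coefficient of the form is [6 a^2]. *)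
Lemma tame_cubic (a b c : int) :
    ~~ (3 %| a)%Z -> (3 %| b)%Z -> (3 %| c)%Z -> ~~ (9 %| c)%Z ->
  ord 3 (cubic_disc a b c) = 1%N /\ ~~ (9 %| bqf_r (cubic_form a b c))%Z.
Proof.
move=> na /dvdzP[b1 ->] /dvdzP[c1 ->] nc.
have {}nc : ~~ (3 %| c1)%Z.
  by apply: contra nc => /dvdzP[q ->]; apply/dvdzP; exists q; ring.
split.
  have -> : cubic_disc a (b1 * 3) (c1 * 3) =
      3%:Z ^+ 1 * (3 * (a ^+ 2 * b1 ^+ 2 - 12 * b1 ^+ 3
      + 18 * a * b1 * c1 - 27 * c1 ^+ 2) - 4 * (a ^+ 3 * c1)).
    by rewrite /cubic_disc; ring.
  rewrite ord_pfactor // rpredBl ?[(_ %| 3 * _)%Z]dvdz_mulr // Gauss_dvdzr //.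
  by rewrite !exprS expr0 !Euclid_dvdzM // ?(negPf na) ?(negPf nc).
rewrite /=; apply: contra na => /dvdzP[q hq].
(* The witness comes from [a^2 = 3 a^2 - 2 a^2] and [2 a^2 = 3 q + 18 b1]. *)
have : (3 %| a ^+ 2)%Z by apply/dvdzP; exists (a ^+ 2 - q - 6 * b1); lia.
by rewrite expr2 Euclid_dvdzM // orbb.
Qed.

(** * Ideals above 3 *)

Section Ideals.
Variable K : fieldExtType rat.
Implicit Types (x y z : K) (I J P : set K).
Local Notation O := (ringOfIntegers K).
Local Notation O3 := (principal_ideal (3%:R : K)).

Lemma O_int (n : int) : O n%:~R.
Proof. exact: integral_id. Qed.

Lemma O_nat (n : nat) : O n%:R.
Proof. exact: integral_nat. Qed.

Lemma OD x y : O x -> O y -> O (x + y).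
Proof. exact: integral_add. Qed.

Lemma OB x y : O x -> O y -> O (x - y).
Proof. exact: integral_sub. Qed.

Lemma OM x y : O x -> O y -> O (x * y).
Proof. exact: integral_mul. Qed.

Lemma OX x n : O x -> O (x ^+ n).
Proof.
move=> Ox; elim: n => [|n IH]; first exact: (O_nat 1).
by rewrite exprS; apply: OM.
Qed.

Lemma O_horner (p : {poly int}) x : O x -> O (map_poly intr p).[x].
Proof.
move=> Ox; apply: integral_horner => //; apply/integral_poly => i.
by rewrite coef_map; apply: O_int.
Qed.

Lemma three_neq0 : 3%:R != 0 :> K.
Proof. by apply/eqP => /(@intr_eq0_fieldExt K 3). Qed.

Lemma ideal_sub I x y : is_ideal I -> I x -> I y -> I (x - y).
Proof.
move=> [_ _ hD hM] Ix Iy; apply: hD => //; rewrite -mulN1r; apply: hM => //.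
exact: (O_int (-1)).
Qed.

Lemma ideal_O3 : is_ideal O3.
Proof.
split.
- by move=> x [y Oy <-]; apply: OM => //; apply: O_nat.
- by exists 0; [apply: (O_nat 0) | rewrite mulr0].
- by move=> x y [u Ou <-] [v Ov <-]; exists (u + v); [apply: OD | rewrite mulrDr].
- by move=> a x Oa [u Ou <-]; exists (a * u); [apply: OM | rewrite mulrCA].
Qed.

Lemma O3_3 x : O x -> O3 (3%:R * x).
Proof. by exists x. Qed.

Lemma ideal_mul_ind I J (Q : K -> Prop) : Q 0 ->
    (forall x y, Q x -> Q y -> Q (x + y)) ->
    (forall x y, I x -> J y -> Q (x * y)) ->
  forall z, ideal_mul I J z -> Q z.
Proof.
move=> Q0 QD QM z [s [hs ->]]; elim: s hs => [|u s IH] hs; first by rewrite big_nil.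
rewrite big_cons; apply: QD.
  by have [] := hs u (mem_head _ _) => *; apply: QM.
by apply: IH => v vs; apply: hs; rewrite in_cons vs orbT.
Qed.

Lemma mem_ideal_mul I J x y : I x -> J y -> ideal_mul I J (x * y).
Proof.
move=> Ix Jy; exists [:: (x, y)]; split; last by rewrite big_seq1.
by move=> u; rewrite inE => /eqP ->.
Qed.

Lemma ideal_mul_subl I J : is_ideal I -> is_ideal J ->
  forall z, ideal_mul I J z -> I z.
Proof.
move=> [_ I0 ID IM] [JO _ _ _] z; apply: ideal_mul_ind => // x y Ix /JO Oy.
by rewrite mulrC; apply: IM.
Qed.

(** Induction on the polynomial. A constant term divisible by 3 lies in [P], and primality cancels a
    factor [x]; the leading coefficient ensures that this stops. Any other constant term is
    invertible modulo 3 and yields an inverse of [x]. *)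
Lemma prime_horner_inv P x (p : {poly int}) : is_prime_ideal P -> P 3%:R ->
    O x -> ~ P x -> ~~ (3 %| lead_coef p)%Z -> P (map_poly intr p).[x] ->
  exists2 y, O y & P (1 - x * y).
Proof.
move=> [hP P1 Pp] P3 Ox nPx; have [_ P0 PD PM] := hP.
elim/poly_ind: p => [|p c IH]; first by rewrite lead_coef0 dvdz0.
rewrite rmorphD rmorphM /= map_polyX map_polyC /= !hornerE => lc hp.
have Op := O_horner p Ox.
have [/dvdzP[k ck]|nc] := boolP (3 %| c)%Z.
  have Pc : P c%:~R by rewrite ck intrM; apply: PM => //; apply: O_int.
  have : P ((map_poly intr p).[x] * x).
    by rewrite -(addrK c%:~R (_ * _)); apply: ideal_sub.
  case/Pp => // Ppx; apply: IH => //.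
  apply: contra lc; case: (eqVneq p 0) => [->|p0].
    by rewrite mul0r add0r lead_coefC ck dvdz_mull.
  rewrite lead_coefDl ?lead_coefMX // size_mulX // ltnS.
  by apply: leq_trans (size_polyC_leq1 _) _; rewrite size_poly_gt0.
(* Modulo [P], [x p(x)] is [- c], and [c^2] is 1 modulo 3. *)
exists (- c%:~R * (map_poly intr p).[x]).
  by apply: OM => //; rewrite -intrN; apply: O_int.
have [k hk] : exists k : int, c ^+ 2 = 1 + k * 3.
  have : (c %% 3 = 1 \/ c %% 3 = 2)%Z by move: nc; lia.
  case=> h; rewrite (divz_eq c 3) h; set q := (c %/ 3)%Z.
    by exists (3 * q ^+ 2 + 2 * q); ring.
  by exists (3 * q ^+ 2 + 4 * q + 1); ring.
have -> : 1 - x * (- c%:~R * (map_poly intr p).[x]) =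
    c%:~R * ((map_poly intr p).[x] * x + c%:~R) - k%:~R * 3%:R.
  have : (c ^+ 2)%:~R = (1 + k * 3)%:~R :> K by rewrite hk.
  rewrite rmorphXn rmorphD rmorphM /= => h.
  by rewrite [_ * (_ + _)]mulrDr -[c%:~R * c%:~R]expr2 h; ring.
by apply: ideal_sub => //; apply: PM => //; apply: O_int.
Qed.

(** Primes containing 3 are maximal: the monic equation of [x] has leading coefficient 1, prime to
    3. *)
Lemma prime_inv P x : is_prime_ideal P -> P 3%:R -> O x -> ~ P x ->
  exists2 y, O y & P (1 - x * y).
Proof.
move=> hP P3 Ox nPx; have [p mp rp] := Ox.
apply: (@prime_horner_inv P x p) => //; first by rewrite (monicP mp).
by rewrite (rootP rp); case: hP => -[].
Qed.

(** One of the two primes has an element outside the other; multiplying it by an inverse modulo that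
    other prime gives the decomposition of 1. *)
Lemma prime_comaximal P1 P2 : is_prime_ideal P1 -> is_prime_ideal P2 ->
  P1 3%:R -> P2 3%:R -> P1 <> P2 -> exists2 x, P1 x & P2 (1 - x).
Proof.
move=> hP1 hP2 h1 h2 ne; have [i1 _ _] := hP1; have [i2 _ _] := hP2.
have [O1 _ _ M1] := i1; have [O2 _ _ M2] := i2.
have [[x Px nPx]|h] := pselect (exists2 x, P1 x & ~ P2 x).
  have [y Oy hy] := prime_inv hP2 h2 (O1 _ Px) nPx.
  by exists (x * y) => //; rewrite mulrC; apply: M1.
have [[x Px nPx]|h'] := pselect (exists2 x, P2 x & ~ P1 x).
  have [y Oy hy] := prime_inv hP1 h1 (O2 _ Px) nPx.
  by exists (1 - x * y) => //; rewrite opprB addrC subrK mulrC; apply: M2.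
case: ne; apply/seteqP; split => x Px; apply: contrapT => nPx.
  by apply: h; exists x.
by apply: h'; exists x.
Qed.

(* Otherwise [P^2] is contained in [3 O], so that [3 O = P^3] is contained in [3 P]. *)
Lemma wild_generator : wildly_ramified3 K ->
  exists t, [/\ O t, O3 (t ^+ 3) & ~ O3 (t ^+ 2)].
Proof.
move=> [P [[hP P1 _] e3]]; have [PO P0 PD PM] := hP; apply: contrapT => hn.
have [O30 O3D O3M] : [/\ O3 0, forall x y, O3 x -> O3 y -> O3 (x + y) &
   forall a x, O a -> O3 x -> O3 (a * x)] by case: ideal_O3.
have sq x : P x -> O3 (x ^+ 2).
  move=> Px; apply: contrapT => n2; apply: hn; exists x; split => //; first exact: PO.
  by rewrite e3 exprSr expr2; do 2?apply: mem_ideal_mul.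
have PP x y : P x -> P y -> O3 (x * y).
  move=> Px Py.
  (* Polarization, with 2 equal to [- 1] modulo 3. *)
  have -> : x * y = 3%:R * (x * y) - ((x + y) ^+ 2 - x ^+ 2 - y ^+ 2) by ring.
  apply: (ideal_sub ideal_O3); first by apply: O3_3; apply: OM; apply: PO.
  by do 2?apply: (ideal_sub ideal_O3); apply: sq => //; apply: PD.
have h3 : ideal_mul (ideal_mul P P) P (3%:R : K).
  by rewrite -e3; exists 1; [apply: (O_nat 1) | rewrite mulr1].
have sub3 z : ideal_mul (ideal_mul P P) P z -> exists2 p, P p & z = 3%:R * p.
  move: z; apply: ideal_mul_ind.
  - by exists 0; rewrite ?mulr0.
  - by move=> x y [p Pp ->] [q Pq ->]; exists (p + q); [apply: PD | rewrite mulrDr].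
  move=> x y hx Py; have [z Oz <-] : O3 x.
    by apply: ideal_mul_ind hx.
  by exists (z * y); [apply: PM | rewrite mulrA].
(* Applied to 3 itself, this gives [3 = 3 p] with [p] in [P]. *)
have [p Pp h] := sub3 _ h3; apply: P1; suff -> : 1 = p by [].
by apply: (mulfI three_neq0); rewrite mulr1.
Qed.

(** Comaximality gives [t] in [P] with [1 - t] in [Q]. Then [t^2 (t - 1)] lies in [P^2 Q], and [t]
    is outside [Q], so [t^2] is outside [3 O]. Only [t (t - 1)] may fall into [3 O]; then [t] is
    corrected by some [x (1 - t)] outside [3 O] with [x] in [P]. *)
Lemma tame_generator : tamely_ramified3 K ->
  exists t, [/\ O t, O3 (t ^+ 2 * (t - 1)), ~ O3 (t * (t - 1)) & ~ O3 (t ^+ 2)].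
Proof.
move=> [P [Q [hP hQ ne e3]]].
have [iP P1 _] := hP; have [iQ Q1 Qp] := hQ.
have [PO P0 PD PM] := iP; have [QO Q0 QD QM] := iQ.
have [_ O30 O3D O3M] := ideal_O3.
have h3 : ideal_mul (ideal_mul P P) Q (3%:R : K).
  by rewrite -e3; exists 1; [apply: (O_nat 1) | rewrite mulr1].
have iPP z : ideal_mul P P z -> P z by exact: ideal_mul_subl.
have P3 : P 3%:R.
  apply: ideal_mul_ind h3 => // x y /iPP Px /QO Oy; by rewrite mulrC; apply: PM.
have Q3 : Q 3%:R.
  apply: ideal_mul_ind h3 => // x y /iPP /PO; exact: QM.
have O3Q z : O3 z -> Q z by move=> [y Oy <-]; rewrite mulrC; apply: QM.
have O3PPQ x y z : P x -> P y -> Q z -> O3 (x * y * z).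
  by move=> *; rewrite e3; do 2?apply: mem_ideal_mul.
have good t : P t -> Q (1 - t) -> ~ O3 (t * (t - 1)) ->
    exists t, [/\ O t, O3 (t ^+ 2 * (t - 1)), ~ O3 (t * (t - 1)) & ~ O3 (t ^+ 2)].
  move=> Pt Qt nt; exists t; split => //; first exact: PO.
    have -> : t ^+ 2 * (t - 1) = -1 * (t * t * (1 - t)) by ring.
    by apply: O3M; [apply: (O_int (-1)) | apply: O3PPQ].
  move=> /O3Q; rewrite expr2 => /(Qp _ _ (PO _ Pt) (PO _ Pt)) Qtt.
  have {}Qtt : Q t by case: Qtt.
  by apply: Q1; rewrite -(subrK t 1); apply: QD.
have [t Pt Qt] := prime_comaximal hP hQ P3 Q3 ne.
have [id|] := pselect (O3 (t * (t - 1))); last exact: good.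
have O1t : O (1 - t) by apply: QO.
have [[x Px nx]|hn] := pselect (exists2 x, P x & ~ O3 (x * (1 - t))).
  apply: (good (t + x * (1 - t))).
  - by apply: PD => //; rewrite mulrC; apply: PM.
  - have -> : 1 - (t + x * (1 - t)) = (1 - x) * (1 - t) by ring.
    by apply: QM => //; apply: OB; [apply: (O_nat 1) | apply: PO].
  (* With [t' := t + x (1 - t)], [t' (t' - 1)] is [- x (1 - t)] modulo 3. *)
  move=> h; apply: nx.
  have -> : x * (1 - t) = (1 - 2%:R * x) * (t * (t - 1)) + x * x * (1 - t) * (1 - t)
    - (t + x * (1 - t)) * (t + x * (1 - t) - 1) by ring.
  apply: (ideal_sub ideal_O3) => //; apply: O3D.
    apply: O3M => //; apply: OB; first exact: (O_nat 1).
    by apply: OM; [apply: O_nat | apply: PO].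
  by rewrite mulrC; apply: O3M => //; apply: O3PPQ.
(* Now [P (1 - t)] is contained in [3 O], so that [3 (1 - t)] lies in [3 P]. *)
have sub3 z : ideal_mul (ideal_mul P P) Q z ->
    exists2 p, P p & z * (1 - t) = 3%:R * p.
  move: z; apply: ideal_mul_ind => //.
  - by exists 0; rewrite ?mulr0 ?mul0r.
  - move=> x y [p Pp hp] [q Pq hq]; exists (p + q); first exact: PD.
    by rewrite mulrDl hp hq mulrDr.
  move=> x y hx Qy; move: x hx; apply: ideal_mul_ind.
  - by exists 0; rewrite ?mulr0 ?mul0r.
  - move=> x z [p Pp hp] [q Pq hq]; exists (p + q); first exact: PD.
    by rewrite (mulrDl x z) (mulrDl (x * y)) hp hq mulrDr.
  move=> x z Px Pz; have [w Ow hw] : O3 (x * (1 - t)).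
    by apply: contrapT => h; apply: hn; exists x.
  exists (w * y * z); first by apply: PM => //; apply: OM => //; apply: QO.
  have -> : x * z * y * (1 - t) = x * (1 - t) * y * z by ring.
  by rewrite -hw; ring.
have [p Pp /(mulfI three_neq0) h] := sub3 _ h3; case: P1.
by rewrite -(subrK t 1); apply: PD => //; rewrite h.
Qed.

(** Linear independence of [1, x, x^2] in O/3O over the field with three elements, stated on
    integral lifts. *)
Definition independent_mod3 x := forall u v w : int,
  O3 (u%:~R + v%:~R * x + w%:~R * x ^+ 2) -> [&& (3 %| u)%Z, (3 %| v)%Z & (3 %| w)%Z].

Lemma O3_dvd (n : int) : (3 %| n)%Z -> O3 n%:~R.
Proof. by move=> /dvdzP[k ->]; rewrite intrM mulrC; apply: O3_3; apply: O_int. Qed.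

(** By Bezout, if 3 did not divide [n], [x] would be an integral combination of [n x] and [3 x]. *)
Lemma O3_intM (n : int) x : ~ O3 x -> O3 (n%:~R * x) -> O x -> (3 %| n)%Z.
Proof.
move=> nx hx Ox; apply: contrapT => /negP nc; apply: nx.
have [_ _ O3D O3M] := ideal_O3.
have [k [m hk]] : exists k m : int, 1 = k * n + m * 3.
  have [h|h] : (n %% 3 = 1 \/ n %% 3 = 2)%Z by move: nc; lia.
    by exists 1, (- (n %/ 3)%Z); rewrite {1}(divz_eq n 3) h; ring.
  by exists (-1), ((n %/ 3)%Z + 1); rewrite {1}(divz_eq n 3) h; ring.
have -> : x = k%:~R * (n%:~R * x) + 3%:R * (m%:~R * x).
  have h : k%:~R * n%:~R + m%:~R * 3%:R = 1 :> K.
    by rewrite -[3%:R]/((3 : int)%:~R) -!intrM -intrD -hk.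
  transitivity ((k%:~R * n%:~R + m%:~R * 3%:R) * x); first by rewrite h mul1r.
  by ring.
apply: O3D; first by apply: O3M => //; apply: O_int.
by apply: O3_3; apply: OM => //; apply: O_int.
Qed.

(** Multiplying the relation by [x^2], then [x], then 1 isolates [u], [v] and [w] in turn in front
    of [x^2], since [x^3] vanishes modulo 3. *)
Lemma wild_independent x : O x -> O3 (x ^+ 3) -> ~ O3 (x ^+ 2) -> independent_mod3 x.
Proof.
move=> Ox h3 n2 u v w h; have [_ _ O3D O3M] := ideal_O3.
have O2 : O (x ^+ 2) by apply: OX.
have hu : (3 %| u)%Z.
  apply: (O3_intM n2) => //.
  have -> : u%:~R * x ^+ 2 = x ^+ 2 * (u%:~R + v%:~R * x + w%:~R * x ^+ 2)
     - (v%:~R + w%:~R * x) * x ^+ 3 by ring.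
  apply: (ideal_sub ideal_O3); first exact: O3M.
  by apply: O3M => //; apply: OD; [|apply: OM => //]; apply: O_int.
have h' : O3 (v%:~R * x + w%:~R * x ^+ 2).
  rewrite -[X in O3 X](addKr u%:~R) addrC addrA; apply: (ideal_sub ideal_O3) => //.
  exact: O3_dvd.
have hv : (3 %| v)%Z.
  apply: (O3_intM n2) => //.
  have -> : v%:~R * x ^+ 2 = x * (v%:~R * x + w%:~R * x ^+ 2) - w%:~R * x ^+ 3 by ring.
  by apply: (ideal_sub ideal_O3); apply: O3M => //; apply: O_int.
rewrite hu hv /=; apply: (O3_intM n2) => //.
have -> : w%:~R * x ^+ 2 = (v%:~R * x + w%:~R * x ^+ 2) - x * v%:~R by ring.
by apply: (ideal_sub ideal_O3) => //; apply: O3M => //; apply: O3_dvd.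
Qed.

(** Modulo 3, [x^3] is [x^2]. Multiplying the relation by [x (x - 1)] leaves [u x (x - 1)], and by
    [x^2] leaves [(u + v + w) x^2]; what then remains of the relation is [w x (x - 1)]. *)
Lemma tame_independent x : O x -> O3 (x ^+ 2 * (x - 1)) -> ~ O3 (x * (x - 1)) ->
  ~ O3 (x ^+ 2) -> independent_mod3 x.
Proof.
move=> Ox h3 n1 n2 u v w h; have [_ _ O3D O3M] := ideal_O3.
have O2 : O (x ^+ 2) by apply: OX.
have O1 : O (x * (x - 1)) by apply: OM => //; apply: OB => //; apply: (O_nat 1).
have hu : (3 %| u)%Z.
  apply: (O3_intM n1) => //.
  have -> : u%:~R * (x * (x - 1)) = (x * (x - 1)) * (u%:~R + v%:~R * x + w%:~R * x ^+ 2)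
     - (v%:~R + w%:~R * x) * (x ^+ 2 * (x - 1)) by ring.
  apply: (ideal_sub ideal_O3); first exact: O3M.
  by apply: O3M => //; apply: OD; [|apply: OM => //]; apply: O_int.
have hs : (3 %| u + v + w)%Z.
  apply: (O3_intM n2) => //; rewrite !rmorphD /=.
  have -> : (u%:~R + v%:~R + w%:~R) * x ^+ 2 = x ^+ 2 * (u%:~R + v%:~R * x + w%:~R * x ^+ 2)
     - (v%:~R + w%:~R * (x + 1)) * (x ^+ 2 * (x - 1)) by ring.
  apply: (ideal_sub ideal_O3); first exact: O3M.
  apply: O3M => //; apply: OD; [|apply: OM => //]; first exact: O_int.
    exact: O_int.
  by apply: OD => //; apply: (O_nat 1).
have hw : (3 %| w)%Z.
  apply: (O3_intM n1) => //.
  have -> : w%:~R * (x * (x - 1)) = (u%:~R + v%:~R * x + w%:~R * x ^+ 2)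
     - (u%:~R + (x * (u + v + w)%:~R - x * u%:~R)) by rewrite !rmorphD /=; ring.
  apply: (ideal_sub ideal_O3) => //; apply: O3D; first exact: O3_dvd.
  by apply: (ideal_sub ideal_O3); apply: O3M => //; apply: O3_dvd.
rewrite hu hw /= andbT; lia.
Qed.

End Ideals.

(** * Cubic fields *)

Definition bqf_comp (T : bqf) (x1 x2 y1 y2 : int) : bqf :=
  BQF (bqf_eval T x1 x2)
      (2 * bqf_r T * x1 * y1 + bqf_s T * (x1 * y2 + x2 * y1) + 2 * bqf_t T * x2 * y2)
      (bqf_eval T y1 y2).

Lemma bqf_comp_disc T x1 x2 y1 y2 :
  bqf_disc (bqf_comp T x1 x2 y1 y2) = (x1 * y2 - x2 * y1) ^+ 2 * bqf_disc T.
Proof. by rewrite /bqf_disc /= /bqf_eval; ring. Qed.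

Lemma bqf_comp_dvd (d : int) T x1 x2 y1 y2 :
  (d %| bqf_content T)%Z -> (d %| bqf_content (bqf_comp T x1 x2 y1 y2))%Z.
Proof.
rewrite !dvdz_content => /and3P[/dvdzP[r hr] /dvdzP[s hs] /dvdzP[t ht]].
rewrite /= /bqf_eval hr hs ht; apply/and3P; split; apply/dvdzP.
- by exists (r * x1 ^+ 2 + s * x1 * x2 + t * x2 ^+ 2); ring.
- by exists (2 * r * x1 * y1 + s * (x1 * y2 + x2 * y1) + 2 * t * x2 * y2); ring.
- by exists (r * y1 ^+ 2 + s * y1 * y2 + t * y2 ^+ 2); ring.
Qed.

(* Composing with the adjugate substitution multiplies the form by [k^2]. *)
Lemma bqf_comp_dvdE (d : int) T x1 x2 y1 y2 (k := x1 * y2 - x2 * y1) : coprimez d k ->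
  (d %| bqf_content (bqf_comp T x1 x2 y1 y2))%Z = (d %| bqf_content T)%Z.
Proof.
move=> cop; apply/idP/idP; last exact: bqf_comp_dvd.
move/(bqf_comp_dvd y2 (- x2) (- y1) x1); rewrite !dvdz_content.
have cop2 : coprimez d (k ^+ 2) by rewrite coprimezXr.
have -> : bqf_comp (bqf_comp T x1 x2 y1 y2) y2 (- x2) (- y1) x1 =
   BQF (k ^+ 2 * bqf_r T) (k ^+ 2 * bqf_s T) (k ^+ 2 * bqf_t T).
  by rewrite /k /bqf_comp /= /bqf_eval /=; congr BQF; ring.
by rewrite /= !Gauss_dvdzr.
Qed.

Lemma bqf_eval_inj (T U : bqf) :
  (forall x y, bqf_eval T x y = bqf_eval U x y) -> T = U.
Proof.
case: T => r s t; case: U => r' s' t' h.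
have := h 1 0; have := h 0 1; have := h 1 1; rewrite /bqf_eval /=.
by move=> h11 h01 h10; congr BQF; lia.
Qed.

Lemma bqf_comp_eval T x1 x2 y1 y2 u v :
  bqf_eval (bqf_comp T x1 x2 y1 y2) u v = bqf_eval T (u * x1 + v * y1) (u * x2 + v * y2).
Proof. by rewrite /bqf_eval /= /bqf_eval; ring. Qed.

(** * Coordinates and traces in a cubic field *)

Section CubicField.
Variables (K : fieldExtType rat) (a1 a2 : K).
Hypothesis hK : \dim {:K} = 3%N.
Hypothesis hb : integral_basis [tuple 1; a1; a2].
Local Notation O := (ringOfIntegers K).
Local Notation O3 := (principal_ideal (3%:R : K)).

Lemma O_a1 : O a1.
Proof. by have := hb.1 (Ordinal (isT : 1 < 3)%N); rewrite (tnth_nth 0). Qed.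

Lemma O_a2 : O a2.
Proof. by have := hb.1 (Ordinal (isT : 2 < 3)%N); rewrite (tnth_nth 0). Qed.

Lemma int_coords x : O x ->
  exists n0 n1 n2 : int, x = n0%:~R + n1%:~R * a1 + n2%:~R * a2.
Proof.
move=> /hb.2[c [-> _]].
exists (c (inord 0)), (c (inord 1)), (c (inord 2)).
rewrite !big_ord_recl big_ord0 !(tnth_nth 0) /= mulr1 addr0 addrA.
by congr ((c _)%:~R + (c _)%:~R * _ + (c _)%:~R * _); apply/val_inj; rewrite /= inordK.
Qed.

(** The cubic is the characteristic polynomial of multiplication by [x] on the integral basis: the
    row [v] of basis elements is an eigenvector, for the eigenvalue [x], of an integral matrix. *)
Lemma integral_cubic x : O x -> exists a b c : int,
  x ^+ 3 + a%:~R * x ^+ 2 + b%:~R * x + c%:~R = 0.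
Proof.
move=> Ox; pose e := [tuple 1; a1; a2].
have hx j : exists f : {ffun 'I_3 -> int}, x * tnth e j = \sum_i (f i)%:~R * tnth e i.
  by have [|f [? _]] := hb.2 (x * tnth e j); [apply: OM => //; apply: hb.1 | exists f].
have [f hf] := choice hx.
pose N : 'M[int]_3 := \matrix_(i, j) f j i.
pose v : 'rV[K]_3 := \row_i tnth e i.
have hv : v *m map_mx intr N = x *: v.
  apply/rowP => j; rewrite !mxE hf; apply: eq_bigr => i _.
  by rewrite !mxE mulrC.
have v0 : v != 0.
  apply/eqP => /rowP/(_ 0); rewrite !mxE (tnth_nth 0) /= => /eqP.
  by rewrite oner_eq0.
have : eigenvalue (map_mx intr N) x by apply/eigenvalueP; exists v.
rewrite eigenvalue_root_char -map_char_poly => /rootP.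
set p := char_poly N.
have sp : size (map_poly (intr : int -> K) p) = 4.
  by rewrite size_map_poly_id0 ?size_char_poly // (monicP (char_poly_monic N)) oner_eq0.
have p3 : p`_3 = 1.
  by have := char_poly_monic N; rewrite monicE lead_coefE size_char_poly => /eqP.
rewrite horner_coef sp !big_ord_recl big_ord0 !coef_map /= /bump /= p3 => h.
exists p`_2, p`_1, p`_0; rewrite -h; ring.
Qed.

Lemma perpM x y (m n : int) :
  perp (m%:~R * x + n%:~R * y) = m%:~R * perp x + n%:~R * perp y :> K.
Proof.
by rewrite /perp raddfD /= !trQ_mulz scalerDl -!scalerA -!mulzE; ring.
Qed.

(** In degree 3 the trace of [n] is [3 n]; hence coordinates on 1 do not affect the trace-zero
    form. *)
Lemma perp_addz x (n : int) : perp (n%:~R + x) = perp x :> K.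
Proof.
have tn : trQ (n%:~R : K) = n%:~R * 3%:R by rewrite -[n%:~R]mulr1 trQ_mulz trQ1 hK.
rewrite /perp raddfD /= tn scalerDl.
rewrite -scalerA -mulzE.
have -> : (3%:R : rat) *: (1 : K) = 3%:R by rewrite scaler_nat.
by ring.
Qed.

(** As the trace of 1 is 3, the product of the two constants cancels one of the two cross terms. *)
Lemma trQ_perpM x y : trQ (perp x * perp y : K) = 9 * trQ (x * y) - 3 * (trQ x * trQ y).
Proof.
have trA r z : trQ (r%:A * z : K) = r * trQ z by rewrite mulr_algl linearZ.
have -> : perp x * perp y = 9%:~R * (x * y) - 3%:~R * ((trQ y)%:A * x)
    - 3%:~R * ((trQ x)%:A * y) + (trQ x)%:A * ((trQ y)%:A * 1) by rewrite /perp; ring.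
by rewrite raddfD !raddfB /= !trQ_mulz !trA trQ1 hK; ring.
Qed.

Lemma trQ_perp_form x y (u v : int) :
  trQ ((u%:~R * perp x + v%:~R * perp y : K) ^+ 2) =
  u%:~R ^+ 2 * trQ (perp x * perp x) + 2 * u%:~R * v%:~R * trQ (perp x * perp y)
  + v%:~R ^+ 2 * trQ (perp y * perp y).
Proof.
have -> : (u%:~R * perp x + v%:~R * perp y : K) ^+ 2 =
    (u ^+ 2)%:~R * (perp x * perp x) + (2 * u * v)%:~R * (perp x * perp y)
    + (v ^+ 2)%:~R * (perp y * perp y) by rewrite !rmorphM /=; ring.
by rewrite !raddfD /= !trQ_mulz !rmorphM /=; ring.
Qed.

(** * Elements generating an order of index prime to 3 *)

Section Generator.
Variables (t : K) (a b c : int).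
Hypothesis Ot : O t.
Hypothesis ind : independent_mod3 t.
Hypothesis tE : t ^+ 3 + a%:~R * t ^+ 2 + b%:~R * t + c%:~R = 0.

(* Otherwise [(t^2 + a t + b) / 3 = - c / (3 t)] is integral. *)
Lemma generator_norm : (3 %| b)%Z -> ~~ (9 %| c)%Z.
Proof.
move=> /dvdzP[b1 b1e]; apply/negP => /dvdzP[c1 c1e].
pose y := t ^+ 2 + a%:~R * t + b%:~R; pose eta := y / 3%:R.
have n3 := three_neq0 K.
have Oeta : O eta.
  (* Formally, these coefficients come from substituting [t = - 3 c1 / eta] in the cubic and
     clearing denominators. The check below avoids dividing by [t]: 27 times the value at [eta] is a
     multiple of the cubic at [t]. *)
  exists (Poly [:: - (3 * c1 ^+ 2); a * c1; - b1; 1]).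
    by rewrite monicE lead_coefE (PolyK (c := 0)).
  rewrite /root map_Poly_id0 // horner_Poly /=.
  apply/eqP/(mulfI (x := 27%:R : K)).
    by apply/eqP => /(@intr_eq0_fieldExt K 27).
  rewrite mulr0.
  transitivity ((t ^+ 3 + a%:~R * t ^+ 2 + b%:~R * t + c%:~R) *
    (a%:~R * y + t * y - 9%:R * c1%:~R)); last by rewrite tE mul0r.
  rewrite /eta /y b1e c1e !rmorphN /= !rmorphM /=; by field.
(* Integrality of [eta] puts [b + a t + t^2] in [3 O], against independence. *)
have := ind (u := b) (v := a) (w := 1) _; rewrite andbA andbF => h.
suff : false by []. apply: h; exists eta => //.
by rewrite /eta mulrC divfK // /y; ring.
Qed.

(** The determinant is, up to sign, the index of Z[t]. If 3 divided it, the adjugate would supply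
    relations modulo 3 between [t] and [t^2]; independence would make all four entries divisible by
    3, so that [t] itself would be an integer modulo 3. *)
Lemma generator_index : exists (x0 x1 x2 y0 y1 y2 : int),
  [/\ t = x0%:~R + x1%:~R * a1 + x2%:~R * a2,
      t ^+ 2 = y0%:~R + y1%:~R * a1 + y2%:~R * a2 & coprimez 3 (x1 * y2 - x2 * y1)].
Proof.
have [x0 [x1 [x2 hx]]] := int_coords Ot.
have [y0 [y1 [y2 hy]]] := int_coords (OX 2 Ot).
exists x0, x1, x2, y0, y1, y2; split => //.
rewrite /coprimez /gcdz eqz_nat -/(coprime _ _) prime_coprime //.
apply/negP => dk.
have {}dk : (3 %| x1 * y2 - x2 * y1)%Z by rewrite dvdzE.
have [_ _ O3D O3M] := ideal_O3 K.
have rel (u v : int) : (3 %| u * x1 + v * y1)%Z -> (3 %| u * x2 + v * y2)%Z ->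
    (3 %| u)%Z /\ (3 %| v)%Z.
  (* The first coefficient is chosen to cancel the coordinate on 1. *)
  move=> h1 h2; have := ind (u := - (u * x0 + v * y0)) (v := u) (w := v) _.
  have -> : (- (u * x0 + v * y0))%:~R + u%:~R * t + v%:~R * t ^+ 2 =
      a1 * (u * x1 + v * y1)%:~R + a2 * (u * x2 + v * y2)%:~R.
    by rewrite hy hx; rewrite !rmorphN !rmorphD !rmorphM /=; ring.
  move=> h.
  have /h/and3P[_ -> ->] : O3 (a1 * (u * x1 + v * y1)%:~R + a2 * (u * x2 + v * y2)%:~R).
    by apply: O3D; apply: O3M; [exact: O_a1|exact: O3_dvd|exact: O_a2|exact: O3_dvd].
  by [].
have [] := rel y1 (- x1); [by rewrite mulNr mulrC subrr dvdz0 | | move=> dy1 dx1].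
  have -> : y1 * x2 + - x1 * y2 = - (x1 * y2 - x2 * y1) by ring.
  by rewrite rpredN.
have [] := rel y2 (- x2); [ | by rewrite mulNr mulrC subrr dvdz0 | move=> dy2 dx2].
  have -> : y2 * x1 + - x2 * y1 = x1 * y2 - x2 * y1 by ring.
  by [].
have [] // := rel 1 0; rewrite mul1r mul0r addr0 -rpredN //.
Qed.

Lemma generator_basis : basis_of {:K} [tuple 1; t; t ^+ 2].
Proof.
have [x0 [x1 [x2 [y0 [y1 [y2 [hx hy cop]]]]]]] := generator_index.
set k := _ - _ in cop.
have k0 : k != 0 by apply/eqP => k0; rewrite k0 in cop.
have bb : basis_of {:K} [tuple 1; a1; a2].
  by rewrite basisEfree (integral_basis_free hb) subvf hK.
rewrite basisEdim hK /= andbT -(span_basis bb); apply/span_subvP => z.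
set S := span _.
have s1 : 1 \in S by apply: memv_span; rewrite !inE eqxx.
have st : t \in S by apply: memv_span; rewrite !inE eqxx ?orbT.
have stt : t ^+ 2 \in S by apply: memv_span; rewrite !inE eqxx ?orbT.
have sz (n : int) x : x \in S -> n%:~R * x \in S by move=> ?; rewrite mulzE memvZ.
have skz x : k%:~R * x \in S -> x \in S.
  rewrite mulzE => /(memvZ (k%:~R)^-1); rewrite scalerA mulVf ?scale1r //.
  by rewrite intr_eq0.
rewrite !inE => /or3P[] /eqP -> //; apply: skz.
  (* Cramer's rule for [a1], and below for [a2]. *)
  have -> : k%:~R * a1 = (x2 * y0 - y2 * x0)%:~R * 1 + y2%:~R * t + (- x2)%:~R * t ^+ 2.
    by rewrite hy hx /k !rmorphB !rmorphN !rmorphM /=; ring.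
  by rewrite !memvD ?sz.
have -> : k%:~R * a2 = (y1 * x0 - x1 * y0)%:~R * 1 + (- y1)%:~R * t + x1%:~R * t ^+ 2.
  by rewrite hy hx /k !rmorphB !rmorphN !rmorphM /=; ring.
by rewrite !memvD ?sz.
Qed.

(** The matrix is the companion matrix of the cubic. *)
Lemma trQ_generator : trQ t = (- a)%:~R.
Proof.
rewrite (trQ_mxtrace (M := \matrix_(i < 3, j < 3)
   (nth 0 (nth [::] [:: [:: 0; 1; 0]; [:: 0; 0; 1];
      [:: - c%:~R; - b%:~R; - a%:~R]] i) j)) generator_basis).
  by rewrite /mxtrace !big_ord_recl big_ord0 !mxE /= !add0r addr0 rmorphN.
move=> i; rewrite !big_ord_recl big_ord0 !mxE !(tnth_nth 0) /= addr0.
case: i => -[|[|[|//]]] _ /=; rewrite ?scale0r ?scale1r ?add0r ?addr0 ?mulr1 //.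
rewrite -!rmorphN /= -!mulzE !rmorphN /=.
by apply/eqP; rewrite -subr_eq0 -tE; apply/eqP; ring.
Qed.

(** The rows are [t^2], [t^3] and [t^4] reduced by the cubic. *)
Lemma trQ_generator2 : trQ (t ^+ 2) = (a ^+ 2 - 2 * b)%:~R.
Proof.
rewrite (trQ_mxtrace (M := \matrix_(i < 3, j < 3)
   (nth 0 (nth [::] [:: [:: 0; 0; 1]; [:: (- c)%:~R; (- b)%:~R; (- a)%:~R];
      [:: (a * c)%:~R; (a * b - c)%:~R; (a ^+ 2 - b)%:~R]] i) j)) generator_basis).
  rewrite /mxtrace !big_ord_recl big_ord0 !mxE /= !add0r addr0 -rmorphD.
  by congr intr; ring.
move=> i; rewrite !big_ord_recl big_ord0 !mxE !(tnth_nth 0) /= addr0.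
case: i => -[|[|[|//]]] _ /=; rewrite ?scale0r ?scale1r ?add0r ?addr0 ?mulr1 //.
  rewrite -!mulzE !rmorphN /=.
  by apply/eqP; rewrite -subr_eq0 -tE; apply/eqP; ring.
rewrite -!mulzE !rmorphB !rmorphM /=.
apply/eqP; rewrite -subr_eq0 -(mulr0 (t - a%:~R)) -tE; apply/eqP; ring.
Qed.

Lemma trQ_generator3 : trQ (t ^+ 3) = (- a ^+ 3 + 3 * a * b - 3 * c)%:~R.
Proof.
have -> : t ^+ 3 = (- a)%:~R * t ^+ 2 + (- b)%:~R * t + (- c)%:~R * 1.
  by rewrite !rmorphN /=; apply/eqP; rewrite -subr_eq0 -tE; apply/eqP; ring.
rewrite !raddfD /= !trQ_mulz trQ_generator2 trQ_generator trQ1 hK.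
by rewrite -[3%:R]/((3 : int)%:~R) -!intrM -!intrD; congr intr; ring.
Qed.

Lemma trQ_generator4 :
  trQ (t ^+ 4) = (a ^+ 4 - 4 * a ^+ 2 * b + 2 * b ^+ 2 + 4 * a * c)%:~R.
Proof.
have -> : t ^+ 4 = (- a)%:~R * t ^+ 3 + (- b)%:~R * t ^+ 2 + (- c)%:~R * t.
  rewrite !rmorphN /=; apply/eqP; rewrite -subr_eq0 -(mulr0 t) -tE; apply/eqP; ring.
rewrite !raddfD /= !trQ_mulz trQ_generator3 trQ_generator2 trQ_generator.
by rewrite -!intrM -!intrD; congr intr; ring.
Qed.

Lemma generator_form (u v : int) :
  trQ ((u%:~R * perp t + v%:~R * perp (t ^+ 2)) ^+ 2) =
  (bqf_eval (cubic_form a b c) u v)%:~R.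
Proof.
rewrite trQ_perp_form !trQ_perpM -!exprD -exprS -expr2 trQ_generator trQ_generator2.
rewrite trQ_generator3 trQ_generator4 /bqf_eval /=.
rewrite !(rmorphD, rmorphB, rmorphM, rmorphN, rmorphXn) /=; ring.
Qed.

(** The Gram determinant of [1, t, t^2], evaluated on the power sums, is the discriminant of the
    cubic. *)
Lemma generator_disc (dK : int) : is_discriminant K dK ->
  exists m : int, cubic_disc a b c = m ^+ 2 * dK.
Proof.
move=> hd; have [|m] := is_discriminant_gram hd generator_basis.
  move=> i; rewrite (tnth_nth 0); case: i => -[|[|[|//]]] _ /=.
  - exact: (O_nat K 1).
  - exact: Ot.
  - exact: OX.
move=> h; exists m; apply/(@intr_inj rat); rewrite -h.
rewrite (expand_det_row _ 0) !big_ord_recl big_ord0 /cofactor.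
rewrite !(expand_det_row _ 0) !big_ord_recl !big_ord0 /cofactor !det_mx11 !mxE /=.
rewrite !(tnth_nth 0) /= !mulr1 !mul1r -exprS -exprSr -expr2 -exprD.
rewrite trQ_generator trQ_generator2 trQ_generator3 trQ_generator4 trQ1 hK.
rewrite /cubic_disc /bump /=.
rewrite !(rmorphD, rmorphB, rmorphM, rmorphN, rmorphXn) /=; ring.
Qed.

End Generator.
End CubicField.

(** As [perp] kills coordinates on 1, [cubic_form] is [T] after a substitution whose determinant is,
    up to sign, the index of Z[t]; being prime to 3, it preserves the 3-part of the content. *)
Lemma generator_trace_form (K : fieldExtType rat) (a1 a2 t : K) (a b c : int) (T : bqf) :
    \dim {:K} = 3%N -> integral_basis [tuple 1; a1; a2] ->
    ringOfIntegers K t -> independent_mod3 t ->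
    t ^+ 3 + a%:~R * t ^+ 2 + b%:~R * t + c%:~R = 0 ->
    is_trace_zero_form a1 a2 T ->
  exists k : int, [/\ coprimez 3 k,
    bqf_disc (cubic_form a b c) = k ^+ 2 * bqf_disc T &
    forall m, (3%:Z ^+ m %| bqf_content (cubic_form a b c))%Z =
              (3%:Z ^+ m %| bqf_content T)%Z].
Proof.
move=> hK hb Ot ind tE hT.
have [x0 [x1 [x2 [y0 [y1 [y2 [hx hy cop]]]]]]] := generator_index hb Ot ind.
have -> : cubic_form a b c = bqf_comp T x1 x2 y1 y2.
  apply: bqf_eval_inj => u v; rewrite bqf_comp_eval; apply/(@intr_inj rat).
  rewrite -(generator_form hK hb Ot ind tE) hT hy {1}hx -!addrA !(perp_addz hK) !perpM.
  by congr (trQ (_ ^+ 2)); rewrite !rmorphD !rmorphM /=; ring.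
exists (x1 * y2 - x2 * y1); split => //; first exact: bqf_comp_disc.
by move=> m; rewrite bqf_comp_dvdE // coprimezXl.
Qed.

(** * The valuation in the wild and tame cases *)

Unset Implicit Arguments.

Theorem theoremD (K : fieldExtType rat) (hK : \dim {:K} = 3%N)
  (dK : int) (hdK : is_discriminant K dK)
  (L : fieldExtType rat) (hL : is_Q_adjoin_sqrt dK L)
  (dL : int) (hdL : is_discriminant L dL) (h3 : (3 %| dL)%Z)
  (a1 a2 : K) (hb : integral_basis [tuple 1; a1; a2])
  (T : bqf) (hT : is_trace_zero_form a1 a2 T) :
  (wildly_ramified3 K -> ord 3 (bqf_disc (bqf_prim T)) = 0%N) /\
  (tamely_ramified3 K -> ord 3 (bqf_disc (bqf_prim T)) = 2%N).
Proof.
have ordT t a b c : ringOfIntegers K t -> independent_mod3 t ->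
    t ^+ 3 + a%:~R * t ^+ 2 + b%:~R * t + c%:~R = 0 -> cubic_disc a b c != 0 ->
    [/\ bqf_disc T != 0,
      ord 3 (bqf_disc T) = (3 + ord 3 (cubic_disc a b c))%N &
      forall m, (3%:Z ^+ m %| bqf_content (cubic_form a b c))%Z =
                (m <= ord 3 (bqf_content T))%N].
  move=> Ot ind tE D0.
  have [k [cop dE cE]] := generator_trace_form hK hb Ot ind tE hT.
  have k0 : k != 0 by apply/eqP => k0; rewrite k0 in cop.
  have T0 : bqf_disc T != 0.
    apply/eqP => T0; move: dE; rewrite T0 mulr0 cubic_form_disc => /eqP.
    by rewrite mulf_eq0 (negPf D0).
  split=> //; last by move=> m; rewrite cE dvdz_pfactor_ord // content_neq0.
  rewrite -ord_108 // -cubic_form_disc dE ordM ?expf_neq0 //.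
  rewrite [ord 3 (k ^+ 2)]ord_coprime ?add0n //.
  by rewrite dvdzE -prime_coprime // abszX coprimeXr.
have [_ _ O3D O3M] := ideal_O3 K.
split.
  move=> /wild_generator[t [Ot t3 t2]].
  have ind := wild_independent Ot t3 t2.
  have [a [b [c tE]]] := integral_cubic hb Ot.
  (* The cubic expresses [- t^3], an element of [3 O], on [1, t, t^2]. *)
  have /and3P[hc hb3 ha] : [&& (3 %| c)%Z, (3 %| b)%Z & (3 %| a)%Z].
    apply: ind; have -> : c%:~R + b%:~R * t + a%:~R * t ^+ 2 = (-1) * t ^+ 3.
      by apply/eqP; rewrite -subr_eq0 -tE; apply/eqP; ring.
    by apply: O3M => //; apply: (O_int K (-1)).
  have hc9 := generator_norm ind tE hb3.
  have [n disc] := generator_disc hK hb Ot ind tE hdK.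
  have [|D0 [m oD hm]] := wild_cubic ha hb3 hc hc9.
    (* The factor [n^2] does not change the parity of the valuation of [dK], which the resolvent
       makes odd. *)
    rewrite disc mulf_eq0 negb_or => /andP[n0 d0].
    rewrite ordM // oddD /ord abszX lognX oddM /=.
    exact: resolvent_ord_odd d0 hL hdL h3.
  have [T0 oT cT] := ordT _ _ _ _ Ot ind tE D0.
  (* The discriminant of [T] has valuation [2 m + 6] and its content at least [m + 3]. *)
  move: hm; rewrite cT => hm; have := ord_disc_prim 3 T0; lia.
move=> /tame_generator[t [Ot t3 n1 n2]].
have ind := tame_independent Ot t3 n1 n2.
have [a [b [c tE]]] := integral_cubic hb Ot.
(* Modulo 3, [t^3] is [t^2], so the cubic becomes [(a + 1) t^2 + b t + c]. *)
have /and3P[hc hb3 ha] : [&& (3 %| c)%Z, (3 %| b)%Z & (3 %| a + 1)%Z].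
  apply: ind; have -> : c%:~R + b%:~R * t + (a + 1)%:~R * t ^+ 2 =
      (-1) * (t ^+ 2 * (t - 1)).
    by apply/eqP; rewrite -subr_eq0 -tE rmorphD; apply/eqP; ring.
  by apply: O3M => //; apply: (O_int K (-1)).
have hc9 := generator_norm ind tE hb3.
have na : ~~ (3 %| a)%Z by move: ha; lia.
have [oD nr] := tame_cubic na hb3 hc hc9.
have [T0 oT cT] := ordT _ _ _ _ Ot ind tE (ord_gt0_neq0 oD).
have c1 : (1 <= ord 3 (bqf_content T))%N.
  by rewrite -cT dvdz_content /= !dvdz_mulr.
have c2 : ~~ (2 <= ord 3 (bqf_content T))%N.
  by rewrite -cT dvdz_content; apply: contra nr => /and3P[].
(* The discriminant of [T] has valuation [3 + 1 = 4], and the content, of valuation exactly 1,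
   accounts for 2 of it. *)
have := ord_disc_prim 3 T0; lia.
Qed.
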